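(* Assume that $X_N$ and $X_M\subset X_N$ are antipodally symmetric and that $\operatorname{rank}(V_{N,r})=R$, $\operatorname{rank}(V_{M,r})=M$. For any function $f:\mathbb{S}^2\to\mathbb{R}$ the interpolation--regression approximant $\hat p_r[f]$ admits the representation $$\hat p_r[f]=\hat p_r^{+}[f^{+}]+\hat p_r^{-}[f^{-}],$$ where $\hat p_r^{+}[f^{+}]\in\Pi_r^{+}(\mathbb{S}^2)$ and $\hat p_r^{-}[f^{-}]\in\Pi_r^{-}(\mathbb{S}^2)$ are uniquely determined by the two independent constrained minimization problems $$\hat p_r^{+}[f^{+}]=\operatorname*{argmin}_{p\in\Pi_r^{+}(\mathbb{S}^2)}\ \sum_{\boldsymbol{x}_i\in X_N}|p(\boldsymbol{x}_i)-f^{+}(\boldsymbol{x}_i)|^2\quad\text{subject to}\quad p(\boldsymbol{x}_j')=f^{+}(\boldsymbol{x}_j'),\ \boldsymbol{x}_j'\in X_M,$$ and $$\hat p_r^{-}[f^{-}]=\operatorname*{argmin}_{p\in\Pi_r^{-}(\mathbb{S}^2)}\ \sum_{\boldsymbol{x}_i\in X_N}|p(\boldsymbol{x}_i)-f^{-}(\boldsymbol{x}_i)|^2\quad\text{subject to}\quad p(\boldsymbol{x}_j')=f^{-}(\boldsymbol{x}_j'),\ \boldsymbol{x}_j'\in X_M.$$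
   Context: $\Pi_r(\mathbb{S}^2)$ is the space of spherical polynomials of degree at most $r$ on the unit sphere $\mathbb{S}^2\subset\mathbb{R}^3$, of dimension $R=(r+1)^2$. $X_N=\{\boldsymbol{x}_1,\dots,\boldsymbol{x}_N\}\subset\mathbb{S}^2$ is a set of $N$ distinct sampling nodes and $X_M=\{\boldsymbol{x}_1',\dots,\boldsymbol{x}_M'\}\subset X_N$ a subset of $M$ distinct interpolation nodes. Conventions: $N=(n+1)^2$, $M=(m+1)^2$, with integers $0\le m<r<n$. A set $X\subset\mathbb{S}^2$ is antipodally symmetric if $\boldsymbol{x}\in X$ implies $-\boldsymbol{x}\in X$. For a fixed basis $\{b_1,\dots,b_R\}$ of $\Pi_r(\mathbb{S}^2)$, $V_{N,r}=[b_j(\boldsymbol{x}_i)]\in\mathbb{R}^{N\times R}$ and $V_{M,r}=[b_j(\boldsymbol{x}_i')]\in\mathbb{R}^{M\times R}$. For $f:\mathbb{S}^2\to\mathbb{R}$, the interpolation--regression approximant $\hat p_r[f]$ is the (under the rank assumptions, unique) minimizer of $\sum_{i=1}^N|p(\boldsymbol{x}_i)-f(\boldsymbol{x}_i)|^2$ over all $p\in\Pi_r(\mathbb{S}^2)$ subject to $p(\boldsymbol{x}_j')=f(\boldsymbol{x}_j')$, $j=1,\dots,M$. $\Pi_r^{+}(\mathbb{S}^2)=\{p\in\Pi_r(\mathbb{S}^2): p(-\boldsymbol{x})=p(\boldsymbol{x})\ \forall\boldsymbol{x}\in\mathbb{S}^2\}$ and $\Pi_r^{-}(\mathbb{S}^2)=\{p\in\Pi_r(\mathbb{S}^2):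 p(-\boldsymbol{x})=-p(\boldsymbol{x})\ \forall\boldsymbol{x}\in\mathbb{S}^2\}$. For $f:\mathbb{S}^2\to\mathbb{R}$, $f^{+}(\boldsymbol{x})=\frac{f(\boldsymbol{x})+f(-\boldsymbol{x})}{2}$ and $f^{-}(\boldsymbol{x})=\frac{f(\boldsymbol{x})-f(-\boldsymbol{x})}{2}$. *)

(* Defs.v *)
From HB Require Import structures.
From mathcomp Require Import all_boot all_order all_algebra.
From mathcomp Require Import boolp classical_sets functions reals.
From mathcomp Require Import mpoly.

Set Implicit Arguments.
Unset Strict Implicit.
Unset Printing Implicit Defensive.
Import Order.TTheory GRing.Theory Num.Theory.

Local Open Scope classical_set_scope.
Local Open Scope ring_scope.

Definition on_sphere (R : realType) (x : 'rV[R]_3) : bool :=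
  \sum_(i < 3) x 0 i ^+ 2 == 1.

Record sphere (R : realType) := Sphere {
  sphere_val :> 'rV[R]_3;
  sphere_valP : on_sphere sphere_val }.

HB.instance Definition _ (R : realType) := [isSub for @sphere_val R].
HB.instance Definition _ (R : realType) := [Choice of sphere R by <:].

Lemma on_sphereN (R : realType) (x : sphere R) : on_sphere (- (x : 'rV[R]_3)).
Proof.
rewrite /on_sphere; under eq_bigr do rewrite mxE sqrrN.
exact: sphere_valP.
Qed.

Definition antipode (R : realType) (x : sphere R) : sphere R :=
  Sphere (on_sphereN x).

Definition antipodally_symmetric (R : realType) (X : set (sphere R)) : Prop :=
  forall x, X x -> X (antipode x).

(* Spherical polynomials of degree at most r are the restrictions to the sphere
   of trivariate polynomials of total degree at most r; recall that msize is
   one more than the total degree. *)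
Definition sph_poly (R : realType) (r : nat) : set (sphere R -> R) :=
  [set p | exists2 q : {mpoly R[3]},
     (msize q <= r.+1)%N & forall x : sphere R, p x = q.@[fun i => x 0 i]].

Definition sph_poly_even (R : realType) (r : nat) : set (sphere R -> R) :=
  [set p | sph_poly r p /\ forall x, p (antipode x) = p x].

Definition sph_poly_odd (R : realType) (r : nat) : set (sphere R -> R) :=
  [set p | sph_poly r p /\ forall x, p (antipode x) = - p x].

Definition even_part (R : realType) (f : sphere R -> R) : sphere R -> R :=
  fun x => (f x + f (antipode x)) / 2.

Definition odd_part (R : realType) (f : sphere R -> R) : sphere R -> R :=
  fun x => (f x - f (antipode x)) / 2.

Definition is_basis (R : realType) (T : Type) (P : set (T -> R)) (k : nat)
    (b : 'I_k -> T -> R) : Prop :=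
  [/\ forall j, P (b j),
      forall c : 'I_k -> R,
        (forall x, \sum_j c j * b j x = 0) -> forall j, c j = 0
    & forall p, P p ->
        exists c : 'I_k -> R, forall x, p x = \sum_j c j * b j x].

Definition colloc_mx (R : realType) (T : Type) (k l : nat)
    (x : 'I_k -> T) (b : 'I_l -> T -> R) : 'M[R]_(k, l) :=
  \matrix_(i, j) b j (x i).

Definition feasible (R : realType) (T : Type) (M : nat) (x' : 'I_M -> T)
    (P : set (T -> R)) (f : T -> R) : set (T -> R) :=
  [set p | P p /\ forall j, p (x' j) = f (x' j)].

Definition sq_error (R : realType) (T : Type) (N : nat) (x : 'I_N -> T)
    (f p : T -> R) : R :=
  \sum_(i < N) `|p (x i) - f (x i)| ^+ 2.

Definition minimizers (R : realType) (T : Type) (N M : nat)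
    (x : 'I_N -> T) (x' : 'I_M -> T) (P : set (T -> R)) (f : T -> R) :
    set (T -> R) :=
  [set p | feasible x' P f p /\
     forall q, feasible x' P f q -> sq_error x f p <= sq_error x f q].

(* A minimizer picked by choice, with junk value 0 if there is none; it is the
   mathematical argmin only when unique (minimizers x x' P f) (argmin x x' P f)
   holds. With P := sph_poly r it is the interpolation-regression approximant
   of f. *)
Definition argmin (R : realType) (T : Type) (N M : nat)
    (x : 'I_N -> T) (x' : 'I_M -> T) (P : set (T -> R)) (f : T -> R) : T -> R :=
  xget (fun=> 0) (minimizers x x' P f).

(* Main.v *)
(** An antipodally symmetric node set makes the sum of squares split as the sum
    over the even part plus the sum over the odd part, so that the even and odd
    parts of the minimizer of the full problem solve the two parity-restricted
    problems. Existence for the full problem comes from the normal equations on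
    the affine space of interpolating coefficient vectors; uniqueness, for all
    three problems, from the parallelogram identity. *)
Require Import Defs.
From mathcomp Require Import all_boot all_order all_algebra.
From mathcomp Require Import boolp classical_sets functions reals.
From mathcomp Require Import mpoly ring lra.

Import Order.TTheory GRing.Theory Num.Theory.
Local Open Scope classical_set_scope.
Local Open Scope ring_scope.

(** * Gram matrices and constrained least squares for row vectors *)

Lemma row_sqE (R : comPzRingType) (k : nat) (v : 'rV[R]_k) :
  (v *m v^T) 0 0 = \sum_i v 0 i ^+ 2.
Proof. by rewrite mxE; apply: eq_bigr => i _; rewrite mxE expr2. Qed.

Lemma row_sq_ge0 (R : realDomainType) (k : nat) (v : 'rV[R]_k) :
  0 <= (v *m v^T) 0 0.
Proof. by rewrite row_sqE sumr_ge0 // => i _; exact: sqr_ge0. Qed.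

Lemma row_sq_eq0 (R : realDomainType) (k : nat) (v : 'rV[R]_k) :
  v *m v^T = 0 -> v = 0.
Proof.
move=> /matrixP/(_ 0 0); rewrite row_sqE mxE => /eqP.
rewrite psumr_eq0 => [/allP v0|i _]; last exact: sqr_ge0.
apply/rowP => i; rewrite mxE; apply/eqP.
by rewrite -sqrf_eq0; apply: v0; rewrite mem_index_enum.
Qed.

(** If [w *m B *m B^T = 0], then [w *m B] has zero sum of squares, hence vanishes. The two kernels
    thus have equal dimension, so the ranks agree and the obvious inclusion of row spaces is an
    equality. *)
Lemma gram_eqmx (R : realFieldType) (k l : nat) (B : 'M[R]_(k, l)) :
  (B *m B^T :=: B^T)%MS.
Proof.
apply/eqmxP; rewrite -(geq_leqif (mxrank_leqif_eq (submxMl B B^T))) mxrank_tr.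
have: (\rank (kermx (B *m B^T)) <= \rank (kermx B))%N.
  apply/mxrankS/rV_subP => w /sub_kermxP wBB; apply/sub_kermxP/row_sq_eq0.
  by rewrite trmx_mul mulmxA -[X in X *m _]mulmxA wBB mul0mx.
by rewrite !mxrank_ker leq_sub2lE // rank_leq_row.
Qed.

(** The vector [- (u *m B)] is the orthogonal projection of [e] onto the row space of [B]. *)
Lemma normal_equations (R : realFieldType) (k l : nat) (B : 'M[R]_(k, l))
  (e : 'rV[R]_l) : exists u : 'rV[R]_k, (u *m B + e) *m B^T = 0.
Proof.
have: (e *m B^T <= B *m B^T)%MS by rewrite gram_eqmx submxMl.
case/submxP => D eD; exists (- D).
by rewrite mulmxDl eD mulNmx mulNmx mulmxA addNr.
Qed.

(** The solutions of the constraint form a coset [c0 + ker A]. Choosing [c] in it with residual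
    orthogonal to the image of [ker A] under [W] makes Pythagoras apply to every competitor. *)
Lemma constrained_least_squares (R : realFieldType) (l k h : nat)
    (W : 'M[R]_(l, k)) (A : 'M[R]_(l, h)) (F : 'rV[R]_k) (G : 'rV[R]_h) :
  row_full A ->
  exists2 c : 'rV[R]_l, c *m A = G & forall d : 'rV[R]_l, d *m A = G ->
    ((c *m W - F) *m (c *m W - F)^T) 0 0 <=
    ((d *m W - F) *m (d *m W - F)^T) 0 0.
Proof.
move=> fullA; have /submxP[c0 c0A] := submx_full G fullA.
(* The rows of [kermx A *m W] span the changes of [c *m W] that the constraint allows. *)
have [u uB] := normal_equations _ _ _ (kermx A *m W) (c0 *m W - F).
exists (c0 + u *m kermx A).
  by rewrite mulmxDl -mulmxA mulmx_ker mulmx0 addr0.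
move=> d dA.
set c := c0 + _; have cW : c *m W - F = u *m (kermx A *m W) + (c0 *m W - F).
  by rewrite /c mulmxDl -mulmxA addrAC addrC.
have /submxP[v dc] : (d - c <= kermx A)%MS.
  apply/sub_kermxP; rewrite mulmxBl dA /c mulmxDl -mulmxA mulmx_ker mulmx0.
  by rewrite addr0 -c0A subrr.
set g := c *m W - F; set w := v *m (kermx A *m W).
have gw : g *m w^T = 0.
  by rewrite /g cW /w trmx_mul mulmxA uB mul0mx.
have wg : w *m g^T = 0 by rewrite -[LHS]trmxK trmx_mul trmxK gw trmx0.
have -> : d *m W - F = g + w.
  by rewrite /g /w mulmxA -dc mulmxBl [RHS]addrC addrA subrK.
(* With the cross terms zero, the competitor's error exceeds that of [c] by the squared norm of
   [w]. *)
clearbody g w; rewrite linearD /= mulmxDl !mulmxDr gw wg addr0 add0r.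
rewrite [leRHS]mxE lerDl.
exact: row_sq_ge0.
Qed.

(** * Existence and uniqueness of minimizers in spaces of functions *)

Section LeastSquares.
Context {R : realType} {T : Type} {N M : nat} (x : 'I_N -> T) (x' : 'I_M -> T).

Lemma sq_errorE (f p : T -> R) :
  sq_error x f p = \sum_i (p (x i) - f (x i)) ^+ 2.
Proof. by apply: eq_bigr => i _; rewrite real_normK ?num_real. Qed.

Lemma colloc_mx_comb (k l : nat) (z : 'I_k -> T) (b : 'I_l -> T -> R)
    (c : 'rV[R]_l) i :
  (c *m (colloc_mx z b)^T) 0 i = \sum_j c 0 j * b j (z i).
Proof. by rewrite mxE; apply: eq_bigr => j _; rewrite !mxE. Qed.

(** Full column rank makes the transposed collocation matrix row free, so values at the nodes
    determine the coefficients. *)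
Lemma rank_colloc_mx_eq (P : set (T -> R)) (k : nat) (b : 'I_k -> T -> R) :
  is_basis P b -> \rank (colloc_mx x b) = k ->
  forall p q, P p -> P q -> (forall i, p (x i) = q (x i)) -> p = q.
Proof.
move=> [_ _ spanb] rkV p q /spanb[c pE] /spanb[d qE] pq.
have freeV : row_free (colloc_mx x b)^T by rewrite /row_free mxrank_tr rkV.
have /eqP : (\row_j (c j - d j)) *m (colloc_mx x b)^T = 0.
  apply/rowP => i; rewrite colloc_mx_comb mxE.
  under eq_bigr do rewrite mxE mulrBl.
  by rewrite sumrB -pE -qE pq subrr.
rewrite mulmx_free_eq0 // => /eqP cd0; apply/funext => t; rewrite pE qE.
apply: eq_bigr => j _; congr (_ * _); apply/eqP; rewrite -subr_eq0.
by move/rowP/(_ j): cd0; rewrite !mxE => ->.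
Qed.

(** Coefficients in the basis turn the problem into matrix least squares; rank [M] at the
    interpolation nodes makes the constraints solvable for all data. *)
Lemma minimizers_exist (P : set (T -> R)) (k : nat) (b : 'I_k -> T -> R) f :
  is_basis P b -> (forall c : 'I_k -> R, P (fun t => \sum_j c j * b j t)) ->
  \rank (colloc_mx x' b) = M -> exists p, minimizers x x' P f p.
Proof.
move=> [_ _ spanb] combP rkA.
have fullA : row_full (colloc_mx x' b)^T by rewrite /row_full mxrank_tr rkA.
have [c cA cmin] := constrained_least_squares _ _ _ _ (colloc_mx x b)^T _
  (\row_i f (x i)) (\row_i f (x' i)) fullA.
have errE (d : 'rV[R]_k) p : (forall t, p t = \sum_j d 0 j * b j t) ->
    sq_error x f p = ((d *m (colloc_mx x b)^T - \row_i f (x i)) *m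
      (d *m (colloc_mx x b)^T - \row_i f (x i))^T) 0 0.
  move=> pE; rewrite sq_errorE row_sqE; apply: eq_bigr => i _.
  by rewrite pE mxE colloc_mx_comb !mxE.
exists (fun t => \sum_j c 0 j * b j t); split; first split => [//|j].
  by move/rowP/(_ j): cA; rewrite colloc_mx_comb mxE.
move=> q [/spanb[d qE] qf].
have qE' t : q t = \sum_j (\row_j d j) 0 j * b j t.
  by rewrite qE; apply: eq_bigr => j _; rewrite mxE.
rewrite (errE c) // (errE _ _ qE'); apply: cmin.
by apply/rowP => j; rewrite colloc_mx_comb -qE' qf mxE.
Qed.

(* By the parallelogram identity, the midpoint of two minimizers would do
   strictly better unless they agree at the nodes. *)
Lemma minimizers_inj (P : set (T -> R)) (f : T -> R) :
  (forall p q, P p -> P q -> P (fun t => (p t + q t) / 2)) ->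
  (forall p q, P p -> P q -> (forall i, p (x i) = q (x i)) -> p = q) ->
  forall p q, minimizers x x' P f p -> minimizers x x' P f q -> p = q.
Proof.
move=> midP sepP p q [[Pp pf] pmin] [[Pq qf] qmin]; apply: sepP => // i.
have midf : feasible x' P f (fun t => (p t + q t) / 2).
  by split=> [|j]; [exact: midP|rewrite pf qf; field].
have := pmin _ midf; have := qmin _ midf.
have parallelogram : sq_error x f p + sq_error x f q =
    2 * sq_error x f (fun t => (p t + q t) / 2)
    + \sum_i (p (x i) - q (x i)) ^+ 2 / 2.
  by rewrite !sq_errorE mulr_sumr -!big_split; apply: eq_bigr => j _ /=; field.
move=> le_q le_p.
have /eqP : \sum_i (p (x i) - q (x i)) ^+ 2 / 2 = 0.
  apply/le_anti; rewrite sumr_ge0 ?andbT; first by lra.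
  by move=> j _; rewrite divr_ge0 ?sqr_ge0.
rewrite psumr_eq0 => [/allP pq0|j _]; last by rewrite divr_ge0 ?sqr_ge0.
have /implyP/(_ isT) := pq0 i (mem_index_enum i).
by rewrite mulf_eq0 sqrf_eq0 invr_eq0 pnatr_eq0 orbF subr_eq0 => /eqP.
Qed.

(** The existence of a minimizer excludes the default value of [xget]. *)
Lemma argmin_eq (P : set (T -> R)) (f p : T -> R) :
  (forall q, minimizers x x' P f q -> q = p) -> minimizers x x' P f p ->
  argmin x x' P f = p.
Proof. by move=> uniqp minp; apply/uniqp/(@xgetI _ (fun=> 0) _ p). Qed.

End LeastSquares.

(** * Even and odd parts of spherical polynomials *)

Section Parity.
Context {R : realType}.
Implicit Types (f p q : sphere R -> R) (z : sphere R).

Lemma antipodeK : involutive (@antipode R).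
Proof. by move=> z; apply: val_inj; rewrite /= opprK. Qed.

Lemma even_oddE f z : even_part f z + odd_part f z = f z.
Proof. by rewrite /even_part /odd_part; field. Qed.

Lemma even_part_antipode f z : even_part f (antipode z) = even_part f z.
Proof. by rewrite /even_part antipodeK addrC. Qed.

Lemma odd_part_antipode f z : odd_part f (antipode z) = - odd_part f z.
Proof. by rewrite /odd_part antipodeK -mulNr opprB. Qed.

Lemma sph_poly_lin (r : nat) (a : R) p q :
  sph_poly r p -> sph_poly r q -> sph_poly r (fun z => a * p z + q z).
Proof.
move=> [P sP pE] [Q sQ qE]; exists (a *: P + Q) => [|z].
  rewrite (leq_trans (mmeasureD_le _ _ _)) // geq_max sQ andbT.
  exact: leq_trans (msizeZ_le _ _) sP.
by rewrite mevalD mevalZ -pE -qE.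
Qed.

Lemma sph_poly0 (r : nat) : sph_poly r (fun=> 0 : R).
Proof. by exists 0 => [|z]; rewrite ?mmeasure0 ?meval0. Qed.

Lemma sph_poly_comb (r k : nat) (b : 'I_k -> sphere R -> R) (c : 'I_k -> R) :
  (forall j, sph_poly r (b j)) -> sph_poly r (fun z => \sum_j c j * b j z).
Proof.
move=> bP; elim: (index_enum _) => [|j s IH].
  under eq_fun do rewrite big_nil; exact: sph_poly0.
by under eq_fun do rewrite big_cons; exact: sph_poly_lin.
Qed.

(** Substituting the opposite point multiplies each monomial by the sign of its total degree, so the
    degree does not grow. *)
Lemma sph_poly_antipode (r : nat) p :
  sph_poly r p -> sph_poly r (p \o @antipode R).
Proof.
move=> [P sP pE].
exists (\sum_(m <- msupp P) ((-1) ^+ mdeg m * P@_m) *: 'X_[m]).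
  rewrite (leq_trans (mmeasure_sum _ _ _ _)) //.
  rewrite big_seq; elim/big_ind: _ => // [a c le_a le_c|m mP].
    by rewrite geq_max le_a.
  rewrite (leq_trans (msizeZ_le _ _)) // msizeX.
  exact: leq_trans (msize_mdeg_lt mP) sP.
move=> z; rewrite /= pE mevalE raddf_sum /=; apply: eq_bigr => m _.
(* The sign is distributed over the variables, one factor -1 for each occurrence. *)
rewrite mevalZ mevalX mdegE -prodrXr mulrC [RHS]mulrAC; congr (_ * _).
by rewrite -big_split; apply: eq_bigr => i _; rewrite /= mxE -exprMn mulN1r.
Qed.

(** Both parity parts are instances, with [a] equal to 1/2 and [c] to 1/2 or -1/2. *)
Lemma sph_poly_lin_antipode (r : nat) (a c : R) p :
  sph_poly r p -> sph_poly r (fun z => a * p z + c * p (antipode z)).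
Proof.
move=> pP; apply: sph_poly_lin => //.
under eq_fun do rewrite -[_ * _]addr0.
by apply: sph_poly_lin; [exact: sph_poly_antipode|exact: sph_poly0].
Qed.

Lemma sph_poly_even_part (r : nat) p :
  sph_poly r p -> sph_poly_even r (even_part p).
Proof.
move=> pP; split=> [|z]; last exact: even_part_antipode.
have -> : even_part p = fun z => 2^-1 * p z + 2^-1 * p (antipode z).
  by apply/funext => z; rewrite /even_part mulrC mulrDr.
exact: sph_poly_lin_antipode.
Qed.

Lemma sph_poly_odd_part (r : nat) p :
  sph_poly r p -> sph_poly_odd r (odd_part p).
Proof.
move=> pP; split=> [|z]; last exact: odd_part_antipode.
have -> : odd_part p = fun z => 2^-1 * p z + - 2^-1 * p (antipode z).
  by apply/funext => z; rewrite /odd_part mulrC mulrBr mulNr.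
exact: sph_poly_lin_antipode.
Qed.

Lemma sph_polyD (r : nat) p q :
  sph_poly r p -> sph_poly r q -> sph_poly r (p \+ q).
Proof.
move=> pP qP; rewrite (_ : p \+ q = fun z => 1 * p z + q z).
  exact: sph_poly_lin.
by apply/funext => z; rewrite mul1r.
Qed.

Lemma sph_poly_mid (r : nat) p q :
  sph_poly r p -> sph_poly r q -> sph_poly r (fun z => (p z + q z) / 2).
Proof.
move=> /sph_polyD/[apply] pqP.
have := sph_poly_lin r 2^-1 _ _ pqP (sph_poly0 r).
by congr sph_poly; apply/funext => z /=; rewrite addr0 mulrC.
Qed.

(** * Antipodally symmetric nodes and the splitting of the minimization problem *)

Section Nodes.
Context {N M : nat} (x : 'I_N -> sphere R) (x' : 'I_M -> sphere R) (r : nat).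
Hypothesis x_inj : injective x.
Hypothesis x_sym : antipodally_symmetric (range x).
Hypothesis x'_sym : antipodally_symmetric (range x').

Lemma sum_antipode (G : sphere R -> R) :
  \sum_i G (antipode (x i)) = \sum_i G (x i).
Proof.
(* The antipodal map induces a map [s] on indices; distinctness of the nodes makes it injective,
   hence a permutation of a finite set. *)
have /choice[s sE] : forall i, exists j, x j = antipode (x i).
  by move=> i; have [j _] := x_sym _ (imageT x i); exists j.
have s_inj : injective s.
  by move=> i j /(congr1 x); rewrite !sE => /(inv_inj antipodeK) /x_inj.
by rewrite [RHS](reindex_inj s_inj); apply: eq_bigr => i _; rewrite sE.
Qed.

(** Averaging the sum with its antipodal image reduces this to (a^2 + b^2)/2 = ((a + b)/2)^2 + ((a -
    b)/2)^2, where a and b are the errors at a node and at its antipode. *)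
Lemma sq_error_parity f p : sq_error x f p =
  sq_error x (even_part f) (even_part p) + sq_error x (odd_part f) (odd_part p).
Proof.
rewrite !sq_errorE -big_split /=.
transitivity (\sum_i ((p (x i) - f (x i)) ^+ 2 / 2 +
    (p (antipode (x i)) - f (antipode (x i))) ^+ 2 / 2)); last first.
  by apply: eq_bigr => i _; rewrite /even_part /odd_part; field.
rewrite big_split /= (sum_antipode (fun z => (p z - f z) ^+ 2 / 2)) -big_split.
by apply: eq_bigr => i _ /=; field.
Qed.

(** The antipode of an interpolation node is again one; hence the parity parts of [p] interpolate
    those of [f]. *)
Lemma feasible_antipode (P : set (sphere R -> R)) f p j :
  feasible x' P f p -> p (antipode (x' j)) = f (antipode (x' j)).
Proof. by move=> [_ pf]; have [k _ <-] := x'_sym _ (imageT x' j). Qed.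

Lemma even_partD p q : (forall z, p (antipode z) = p z) ->
  (forall z, q (antipode z) = - q z) -> even_part (p \+ q) = p.
Proof.
by move=> pe qo; apply/funext => z; rewrite /even_part /= pe qo; field.
Qed.

Lemma odd_partD p q : (forall z, p (antipode z) = p z) ->
  (forall z, q (antipode z) = - q z) -> odd_part (p \+ q) = q.
Proof.
by move=> pe qo; apply/funext => z; rewrite /odd_part /= pe qo; field.
Qed.

(** An even competitor [q] is completed by the odd part of [p] to a competitor in the full problem.
    Both errors then contain the same odd term, which cancels. *)
Lemma minimizers_even_part f p : minimizers x x' (sph_poly r) f p ->
  minimizers x x' (sph_poly_even r) (even_part f) (even_part p).
Proof.
move=> [p_feas pmin]; have [Pp pf] := p_feas.
split; first split=> [|j]; first exact: sph_poly_even_part.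
  by rewrite /even_part pf (feasible_antipode _ _ _ _ p_feas).
move=> q [[Pq qe] qf]; have po := odd_part_antipode p.
have /pmin : feasible x' (sph_poly r) f (q \+ odd_part p).
  split=> [|j].
    by apply: sph_polyD => //; have [] := sph_poly_odd_part r p.
  rewrite /= qf {1}/odd_part pf (feasible_antipode _ _ _ _ p_feas).
  exact: even_oddE.
rewrite (sq_error_parity f p) (sq_error_parity f (q \+ odd_part p)).
by rewrite even_partD // odd_partD // lerD2r.
Qed.

(** The same exchange with the parities swapped: the even part of [p] is kept. *)
Lemma minimizers_odd_part f p : minimizers x x' (sph_poly r) f p ->
  minimizers x x' (sph_poly_odd r) (odd_part f) (odd_part p).
Proof.
move=> [p_feas pmin]; have [Pp pf] := p_feas.
split; first split=> [|j]; first exact: sph_poly_odd_part.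
  by rewrite /odd_part pf (feasible_antipode _ _ _ _ p_feas).
move=> q [[Pq qo] qf]; have pe := even_part_antipode p.
have /pmin : feasible x' (sph_poly r) f (even_part p \+ q).
  split=> [|j].
    by apply: sph_polyD => //; have [] := sph_poly_even_part r p.
  rewrite /= qf {1}/even_part pf (feasible_antipode _ _ _ _ p_feas).
  exact: even_oddE.
rewrite (sq_error_parity f p) (sq_error_parity f (even_part p \+ q)).
by rewrite even_partD // odd_partD // lerD2l.
Qed.

End Nodes.
End Parity.

Theorem theorem3 (R : realType) (m r n : nat) (lt_mr : (m < r)%N) (lt_rn : (r < n)%N)
  (x : 'I_(n.+1 ^ 2) -> sphere R) (x' : 'I_(m.+1 ^ 2) -> sphere R)
  (x_inj : injective x) (x'_inj : injective x')
  (x'_sub : range x' `<=` range x)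
  (x_sym : antipodally_symmetric (range x))
  (x'_sym : antipodally_symmetric (range x'))
  (b : 'I_(r.+1 ^ 2) -> sphere R -> R) (b_basis : is_basis (sph_poly r) b)
  (rank_N : \rank (colloc_mx x b) = (r.+1 ^ 2)%N)
  (rank_M : \rank (colloc_mx x' b) = (m.+1 ^ 2)%N)
  (f : sphere R -> R) :
  [/\ unique (minimizers x x' (sph_poly r) f) (argmin x x' (sph_poly r) f),
      unique (minimizers x x' (sph_poly_even r) (even_part f))
             (argmin x x' (sph_poly_even r) (even_part f)),
      unique (minimizers x x' (sph_poly_odd r) (odd_part f))
             (argmin x x' (sph_poly_odd r) (odd_part f))
    & argmin x x' (sph_poly r) f =
      argmin x x' (sph_poly_even r) (even_part f)
        \+ argmin x x' (sph_poly_odd r) (odd_part f)].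
Proof.
have [bP _ _] := b_basis.
have [p pmin] := minimizers_exist x x' _ _ _ f b_basis
  (fun c => sph_poly_comb r _ b c bP) rank_M.
have sep := rank_colloc_mx_eq x _ _ _ b_basis rank_N.
have min_inj g : forall p q, minimizers x x' (sph_poly r) g p ->
    minimizers x x' (sph_poly r) g q -> p = q.
  by apply: minimizers_inj sep => p1 p2; exact: sph_poly_mid.
(* Separation by the nodes is inherited from the full space; only closure under midpoints has to be
   checked for each parity. *)
have even_inj g : forall p q, minimizers x x' (sph_poly_even r) g p ->
    minimizers x x' (sph_poly_even r) g q -> p = q.
  apply: minimizers_inj => [p1 p2 [P1 e1] [P2 e2]|p1 p2 [P1 _] [P2 _]].
    by split=> [|z]; [exact: sph_poly_mid|rewrite e1 e2].
  exact: sep.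
have odd_inj g : forall p q, minimizers x x' (sph_poly_odd r) g p ->
    minimizers x x' (sph_poly_odd r) g q -> p = q.
  apply: minimizers_inj => [p1 p2 [P1 o1] [P2 o2]|p1 p2 [P1 _] [P2 _]].
    by split=> [|z]; [exact: sph_poly_mid|rewrite o1 o2 -opprD mulNr].
  exact: sep.
(* Existence for the parity problems comes from the parts of the full minimizer [p]. *)
have emin := minimizers_even_part x x' r x_inj x_sym x'_sym f p pmin.
have omin := minimizers_odd_part x x' r x_inj x_sym x'_sym f p pmin.
rewrite !(argmin_eq _ _ _ _ _ _ pmin) ?(argmin_eq _ _ _ _ _ _ emin)
  ?(argmin_eq _ _ _ _ _ _ omin); try by move=> q ?; eauto.
split; try by split=> // q ?; eauto.
(* With all three [argmin] identified, the representation is the parity splitting of [p]. *)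
by apply/funext => z; rewrite /= even_oddE.
Qed.
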